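(* Let $S$ be a topological Clifford semigroup whose underlying topological space is regular, and let $E=\{e\in S: ee=e\}$ be its set of idempotents. Then $S$ is metrizable if and only if $S$ is an $M$-space and $E$ is a metrizable $G_\delta$-set in $S$ (that is, $E$ is metrizable in the subspace topology and $E$ is the intersection of countably many open subsets of $S$).
   Context: All topological spaces are assumed to be regular (including the $T_1$ axiom). A topological semigroup is a topological space $S$ endowed with a continuous associative operation $\cdot:S\times S\to S$. A Clifford topological semigroup is a topological semigroup $S$ that is algebraically Clifford, i.e. $S$ is the union of its subsemigroups that are groups. For each element $x$ of a Clifford semigroup there is a unique element $x^{-1}\in S$ such that $xx^{-1}x=x$, $x^{-1}xx^{-1}=x^{-1}$ and $xx^{-1}=x^{-1}x$; it is called the inverse of $x$, and the map $x\mapsto x^{-1}$ is called the inversion on $S$. A topological Clifford semigroup is a Clifford topological semigroup whose inversion $S\to S$ is continuous. For a cover $\mathcal U$ of a space $X$, a point $x\in X$ and a set $A\subset X$, let $\mathrm{St}(x,\mathcal U)=\bigcup\{U\in\mathcal U: x\in U\}$ and $\mathrm{St}(A,\mathcal U)=\bigcup\{U\in\mathcal U: U\cap A\neq\emptyset\}$. A cover $\mathcal V$ star refines a cover $\mathcal U$ if for each $V\in\mathcal V$ there is $U\in\mathcal U$ with $\mathrm{St}(V,\mathcal V)\subset U$. A topological space $X$ is an $M$-space if there is a sequence $(\mathcal U_n)_{n\in\omega}$ of open covers of $X$ such that each $\mathcal U_{n+1}$ star refines $\mathcal U_n$, and for every point $x\in X$, every sequence $(x_n)_{n\in\omega}$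 with $x_n\in\mathrm{St}(x,\mathcal U_n)$ for all $n\in\omega$ has a cluster point in $X$. *)

(* Defs.v *)
From HB Require Import structures.
From mathcomp Require Import all_boot all_order all_algebra.
From mathcomp Require Import all_classical all_reals all_analysis.
From mathcomp Require Import borel_hierarchy.

Set Implicit Arguments.
Unset Strict Implicit.
Unset Printing Implicit Defensive.

Import Order.TTheory GRing.Theory Num.Theory.
Import numFieldNormedType.Exports.

Local Open Scope classical_set_scope.

(* The multiplication is that of [semigroupType] from [monoid]; the library has
   the [topologicalZmodType] of abelian topological groups, but no topological
   semigroups. *)
HB.mixin Record isTopologicalSemigroup S of Semigroup S & Topological S := {
  mul_continuous : continuous (fun p : S * S => (p.1 * p.2)%g)
}.

#[short(type="topologicalSemigroupType")]
HB.structure Definition TopologicalSemigroup :=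
  { S of Semigroup S & Topological S & isTopologicalSemigroup S }.

Section Clifford.
Context {S : semigroupType}.
Implicit Types (x y e : S) (H : set S).

Definition idempotents : set S := [set e | (e * e)%g = e].

(* [H] is a subsemigroup of [S] which is a group for the induced operation; its
   identity [e] need not be an identity of [S]. *)
Definition is_subgroup H : Prop :=
  (forall x y, H x -> H y -> H (x * y)%g) /\
  exists e, [/\ H e,
    forall x, H x -> (e * x)%g = x /\ (x * e)%g = x &
    forall x, H x -> exists y, [/\ H y, (x * y)%g = e & (y * x)%g = e]].

Definition clifford : Prop := \bigcup_(H in is_subgroup) H = [set: S].

Definition is_inverse x y : Prop :=
  [/\ (x * y * x)%g = x, (y * x * y)%g = y & (x * y)%g = (y * x)%g].

(* The default value [x] is never reached in a Clifford semigroup, see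
   [inversionP]. *)
Definition inversion x : S := xget x [set y | is_inverse x y].

Lemma is_inverse_uniq x y z : is_inverse x y -> is_inverse x z -> y = z.
Proof.
move=> [xyx yxy xy] [xzx zxz xz].
have e : (x * y = x * z)%g.
  by rewrite xy -[in LHS]xzx -(mulgA x z x) -xz mulgA -xy !mulgA xyx.
by rewrite -yxy -[RHS]zxz -xz -e xy -!mulgA e.
Qed.

Lemma inversionP x : clifford -> is_inverse x (inversion x).
Proof.
move=> cS; have [H [HM [e [He e1 eV]]] Hx] : (\bigcup_(H in is_subgroup) H) x.
  by rewrite cS.
have [y [Hy xy yx]] := eV _ Hx.
have ixy : is_inverse x y.
  by split; rewrite ?xy ?yx //; [case: (e1 _ Hx) | case: (e1 _ Hy)].
exact: (@xgetPex _ x [set y | is_inverse x y] (ex_intro _ y ixy)).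
Qed.

End Clifford.
Arguments idempotents : clear implicits.
Arguments clifford : clear implicits.

Section Mspace.
Context {X : topologicalType}.
Implicit Types (U V : set (set X)) (A : set X) (x : X).

Definition open_cover U : Prop :=
  (forall A, U A -> open A) /\ \bigcup_(A in U) A = [set: X].

Definition star_point x U : set X := \bigcup_(A in [set A | U A /\ A x]) A.

Definition star_set A U : set X :=
  \bigcup_(B in [set B | U B /\ B `&` A !=set0]) B.

Definition star_refines V U : Prop :=
  forall A, V A -> exists2 B, U B & star_set A V `<=` B.

Definition M_space : Prop :=
  exists U : nat -> set (set X),
    [/\ forall n, open_cover (U n),
        forall n, star_refines (U n.+1) (U n) &
        forall (x : X) (u : nat -> X),
          (forall n, star_point x (U n) (u n)) ->
          exists p : X, cluster (u @ \oo) p].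

End Mspace.
Arguments M_space : clear implicits.

Section Metrizable.
Local Open Scope ring_scope.

Definition is_metric (R : realType) (X : Type) (d : X -> X -> R) : Prop :=
  [/\ forall x y, 0 <= d x y,
      forall x y, d x y = 0 <-> x = y,
      forall x y, d x y = d y x &
      forall x y z, d x z <= d x y + d y z].

Definition metrizable (R : realType) (X : topologicalType) : Prop :=
  exists2 d : X -> X -> R, is_metric d &
    forall A : set X, open A <->
      (forall x, A x -> exists2 e : R, 0 < e & [set y | d x y < e] `<=` A).

Lemma metricType_metrizable (R : realType) (X : metricType R) :
  metrizable R X.
Proof.
exists (@mdist R X); first split.
- exact: mdist_ge0.
- by move=> x y; split=> [/mdist_positivity|->]; rewrite ?mdistxx.
- exact: metric_sym.
- by move=> x y z; exact: metric_triangle.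
move=> A; rewrite openE; split => oA x Ax.
- have /nbhs_ballP[e e0 eA] := oA _ Ax.
  by exists e => //; rewrite -ballEmdist.
- have [e e0 eA] := oA _ Ax.
  by apply/nbhs_ballP; exists e => //; rewrite ballEmdist.
Qed.

End Metrizable.

(* Main.v *)
From HB Require Import structures.
Require Import Defs.
From mathcomp Require Import all_boot all_order all_algebra.
From mathcomp Require Import all_classical all_reals all_analysis.
From mathcomp Require Import borel_hierarchy wochoice.
From mathcomp Require Import zify lra.

(** The metrizability of a topological Clifford semigroup [S] is reduced to two
    facts about general spaces.

    The first one is that an M-space [X] is metrizable as soon as its diagonal
    is the intersection of the closures of countably many of its open
    neighbourhoods in [X * X] ([M_space_metrizable]).  Intersecting these
    neighbourhoods with the entourages [T n] of the M-structure gives a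
    decreasing sequence [G n].  A sequence of points chosen in the sets
    [G n [x]] has a cluster point, which can only be [x]; so these sets form a
    base at [x].  The same compactness argument shows that
    [G m \; G m `<=` G n] holds near [x] for some [m] which depends on [x] and
    [n].  To make up for the dependence on [x], the index is allowed to vary
    with the point: for [f : X -> nat] the relation [G (f x) (x, y)] is
    considered.  When [f] varies slowly along the relations [T n], the least
    index that works at [x] varies slowly as well, so the construction can be
    iterated.  It yields a sequence of relations with
    [V n.+1 \; V n.+1 `<=` V n] which are a base at each point, whence a metric.
    This replaces the usual appeal to paracompactness.

    The second one is that, if a subset [E] of a regular space is metrizable and
    a retract of the space, then each open set containing [E] contains the
    intersection of the closures of countably many open sets containing [E]
    ([retract_closure_sandwich]).  The proof follows that of the paracompactness
    of metric spaces.

    In [S], the map [x |-> x * inversion x] is a continuous retraction onto the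
    set [E] of idempotents.  Moreover [a = b] as soon as [a] and [b] have the
    same image under it and [inversion a * b] is idempotent
    ([clifford_unit_eq]).  So if [E] is metrizable and a G-delta set, the second
    fact gives neighbourhoods of the diagonal as required by the first one:
    those of the pairs [(a, b)] for which the images of [a] and [b] are close
    and [inversion a * b] is close to [E].  Conversely, in a metric space balls
    of radius [4 ^ - n] give an M-structure and [E] is the G-delta set of the
    fixed points of [x |-> x * x]. *)

Set Implicit Arguments.
Unset Strict Implicit.
Unset Printing Implicit Defensive.

Import Order.TTheory GRing.Theory Num.Theory.
Import numFieldNormedType.Exports.

Local Open Scope classical_set_scope.

(** * Metrics from sequences of relations *)

(** The relations [V n] generate a uniformity with a countable base, compatible
    with the topology; the metric is the one of this uniformity, which is finite
    because any two points lie in a common ball of radius 2. *)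
Lemma metrizable_entourage_seq (R : realType) (X : topologicalType)
    (V : nat -> set (X * X)) :
  (forall n x, V n (x, x)) ->
  (forall n x y, V n.+1 (x, y) -> V n (y, x)) ->
  (forall n x y z, V n.+1 (x, y) -> V n.+1 (y, z) -> V n (x, z)) ->
  (forall x y, (forall n, V n (x, y)) -> x = y) ->
  (forall x A, nbhs x A <-> exists n, forall y, V n (x, y) -> A y) ->
  metrizable R X.
Proof.
move=> Vxx Vsym Vtri Vsep Vnbhs.
have VS n x y : V n.+1 (x, y) -> V n (x, y) by move=> /Vtri; apply; exact: Vxx.
have Vle m n x y : (m <= n)%N -> V n (x, y) -> V m (x, y).
  elim: n => [|n IH]; first by rewrite leqn0 => /eqP ->.
  by rewrite leq_eqVlt => /orP[/eqP ->//|]; rewrite ltnS => /IH h /VS.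
pose ent : set_system (X * X) := [set A | exists n, V n `<=` A].
have entF : Filter ent.
  split; first by exists 0.
  - move=> A B [m VA] [n VB]; exists (maxn m n) => -[x y] Vxy; split.
      exact/VA/(Vle _ _ _ _ _ Vxy)/leq_maxl.
    exact/VB/(Vle _ _ _ _ _ Vxy)/leq_maxr.
  - by move=> A B AB [n VA]; exists n; exact: subset_trans AB.
have ent_diag A : ent A -> diagonal `<=` A.
  by move=> [n VA] [x y] xy; apply: VA; rewrite (xy : x = y); exact: Vxx.
have ent_inv A : ent A -> ent A^-1%relation.
  by move=> [n VA]; exists n.+1 => -[x y] /Vsym /VA.
have ent_split A : ent A -> exists2 B, ent B & (B \; B)%relation `<=` A.
  move=> [n VA]; exists (V n.+1); first by exists n.+1.
  by move=> [x z] /= [y /= Vxy Vyz]; exact/VA/(Vtri _ _ y).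
have entE : nbhs = nbhs_ ent.
  apply/funext => x; apply/seteqP; split=> A.
    move=> /Vnbhs[n VA]; exists (V n) => /=; first by exists n.
    by move=> y /xsectionP/VA.
  move=> [B [n VB] BA]; apply/Vnbhs; exists n => y Vxy.
  exact/BA/xsectionP/VB.
pose U : uniformType :=
  HB.pack X (@Nbhs_isUniform.Build X ent entF ent_diag ent_inv ent_split entE).
have cU : countable_uniformity U.
  apply/countable_uniformityP; exists V => [A [n VA]|n]; by exists n.
pose Y : pseudoMetricType R := countable_uniform cU.
have dfin (x y : Y) : edist (x, y) \is a fin_num.
  apply/edist_finP; exists 2%R => //.
  exact: countable_uniform.countable_uniform_bounded.
have dball (x y : Y) (e : R) : (0 < e)%R ->
    ball x e y -> (fine (edist (x, y)) <= e)%R.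
  by move=> e0 xy; rewrite -lee_fin fineK//; exact: edist_fin.
exists (fun x y : Y => fine (edist (x, y))); first split.
- by move=> x y; exact/fine_ge0/edist_ge0.
- move=> x y; split=> [xy0|->]; last by rewrite edist_refl.
  apply: Vsep => n; have : close (x : Y) y.
    by apply/edist_closeP; rewrite -[LHS]fineK// xy0.
  by rewrite entourage_close; apply; exists n.
- by move=> x y; rewrite edist_sym.
- by move=> x y z; rewrite -lee_fin EFinD !fineK//; exact: edist_triangle.
move=> A; rewrite openE; split => oA x Ax.
- have : nbhs (x : Y) A by exact: oA.
  move=> /nbhs_ballP[e e0 eA]; exists e => // y /= xy; apply: eA.
  by apply: (@edist_lt_ball R Y e (x, y)); rewrite -[ltLHS]fineK ?lte_fin.
- have [e e0 eA] := oA _ Ax.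
  suff : nbhs (x : Y) A by [].
  apply/nbhs_ballP; exists (e / 2)%R => /=; first by rewrite divr_gt0.
  move=> y xy; apply: eA => /=; apply: (le_lt_trans (dball _ _ _ _ xy)).
    by rewrite divr_gt0.
  by rewrite ltr_pdivrMr// ltr_pMr// ltr1n.
Qed.

(** * M-spaces whose diagonal is an intersection of closed neighbourhoods *)

(** The relation [T n] is that of belonging to a common member of the n-th
    cover. *)
Lemma M_space_entourages (X : topologicalType) : M_space X ->
  exists T : nat -> set (X * X),
  [/\ forall n, open (T n), forall n x, T n (x, x),
      forall n x y, T n (x, y) -> T n (y, x),
      forall n x y z, T n.+1 (x, y) -> T n.+1 (y, z) -> T n (x, z) &
      forall x (u : nat -> X), (forall n, T n (x, u n)) ->
        exists p, cluster (u @ \oo) p].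
Proof.
move=> [U [Uopen Ustar Uclust]].
exists (fun n => [set xy | exists A, [/\ U n A, A xy.1 & A xy.2]]); split.
- move=> n; rewrite openE => -[x y] /= [A [UA Ax Ay]].
  have oA : open A by apply: (Uopen n).1.
  exists (A, A) => [|[a b] /= [Aa Ab]]; last by exists A.
  by split; exact: open_nbhs_nbhs.
- move=> n x; have [_ /seteqP[_ /(_ x I) [A UA Ax]]] := Uopen n.
  by exists A.
- by move=> n x y [A [UA Ax Ay]]; exists A.
- move=> n x y z [A [UA Ax Ay]] [B [UB By Bz]].
  have [C UC AC] := Ustar n _ UA.
  exists C; split => //; apply: AC; [exists A|exists B] => //=; split => //.
    by exists x.
  by exists y.
- move=> x u Tu; apply: (Uclust x) => n.
  by have [A [UA Ax Au]] := Tu n; exists A.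
Qed.

Section closure_diagonal.
Context (X : topologicalType) (T G : nat -> set (X * X)).
Hypothesis Txx : forall n x, T n (x, x).
Hypothesis Tsym : forall n x y, T n (x, y) -> T n (y, x).
Hypothesis Ttri :
  forall n x y z, T n.+1 (x, y) -> T n.+1 (y, z) -> T n (x, z).
Hypothesis Tcluster : forall x (u : nat -> X), (forall n, T n (x, u n)) ->
  exists p, cluster (u @ \oo) p.
Hypothesis Gopen : forall n, open (G n).
Hypothesis Gxx : forall n x, G n (x, x).
Hypothesis Gsym : forall n x y, G n (x, y) -> G n (y, x).
Hypothesis GS : forall n x y, G n.+1 (x, y) -> G n (x, y).
Hypothesis GT : forall n x y, G n (x, y) -> T n (x, y).
Hypothesis Gdiag : forall x y, (forall n, closure (G n) (x, y)) -> x = y.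

Let Tle m n x y : (m <= n)%N -> T n (x, y) -> T m (x, y).
Proof.
elim: n => [|n IH]; first by rewrite leqn0 => /eqP ->.
rewrite leq_eqVlt => /orP[/eqP ->//|]; rewrite ltnS => /IH h /Ttri Txy.
exact/h/Txy/Txx.
Qed.

Let Gle m n x y : (m <= n)%N -> G n (x, y) -> G m (x, y).
Proof.
elim: n => [|n IH]; first by rewrite leqn0 => /eqP ->.
by rewrite leq_eqVlt => /orP[/eqP ->//|]; rewrite ltnS => /IH h /GS.
Qed.

Let Gdiag_nbhs n (x : X) : nbhs (x, x) (G n).
Proof. by apply: open_nbhs_nbhs; split; [exact: Gopen|exact: Gxx]. Qed.

Let Gnbhs n (x : X) : nbhs x [set y | G n (x, y)].
Proof.
have [[A B] /= [Ax Bx] AB] := Gdiag_nbhs n x.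
apply: filterS Bx => y By; apply: AB; split => //=; exact: nbhs_singleton.
Qed.

Let clusterP (u : nat -> X) p A j : cluster (u @ \oo) p -> nbhs p A ->
  exists2 k, (j <= k)%N & A (u k).
Proof.
move=> up pA; have [_ [[k jk <-] Auk]] := up [set u k | k in [set k | j <= k]%N]
  A (ex_intro2 _ _ j I (fun k jk => ex_intro2 _ _ k jk erefl)) pA.
by exists k.
Qed.

(** Otherwise some points [u n] with [G n (x, u n)] stay outside of [A]; they
    cluster at a point [p] such that [(x, p)] is in the closure of each [G n],
    hence at [x]. *)
Lemma G_base (x : X) A : nbhs x A -> exists n, forall y, G n (x, y) -> A y.
Proof.
move=> xA; apply: contrapT => /forallNP nA.
have /choice[u uP] : forall n, exists y, G n (x, y) /\ ~ A y.
  by move=> n; apply: contrapT => /forallNP h; apply: (nA n) => y Gy;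
     apply: contrapT => Ay; exact: (h y).
have [p up] : exists p, cluster (u @ \oo) p.
  by apply: (Tcluster (x := x)) => n; exact/GT/(uP n).1.
have xp : x = p.
  apply: Gdiag => n B [[B1 B2] /= [B1x B2p] BB].
  have [k nk Buk] := clusterP n up B2p.
  exists (x, u k); split; first exact: Gle nk (uP k).1.
  by apply: BB; split => //=; exact: nbhs_singleton.
have [k _ Auk] : exists2 k, (0 <= k)%N & A (u k).
  by apply: clusterP up _; rewrite -xp.
exact: (uP k).2.
Qed.

(** As the sets [G j [p]] are a base at [p], this says that a subsequence of [u]
    converges to [p].  Unlike cluster points, subsequences can be taken
    successively for several sequences, see [G_local_split]. *)
Lemma cluster_subsequence x (u : nat -> X) : (forall n, T n (x, u n)) ->
  exists p, exists2 f : nat -> nat,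
    (forall j, (j <= f j)%N) & forall j, G j (p, u (f j)).
Proof.
move=> /Tcluster[p up]; exists p.
have /choice[f fP] : forall j, exists k, (j <= k)%N /\ G j (p, u k).
  by move=> j; have [k] := clusterP j up (Gnbhs j p); exists k.
by exists f => j; have [] := fP j.
Qed.

Let Glim (u v : nat -> X) p q : (forall j, G j (u j, v j)) ->
  (forall j, G j (p, u j)) -> (forall j, G j (q, v j)) -> p = q.
Proof.
move=> Guv Gpu Gqv; apply: Gdiag => n B [[B1 B2] /= [B1p B2q] BB].
have [i iB] := G_base B1p; have [j jB] := G_base B2q.
pose k := maxn n (maxn i j); exists (u k, v k); split.
  by apply: Gle (Guv k); rewrite leq_maxl.
apply: BB; split => /=.
  by apply/iB/(Gle _ (Gpu k)); rewrite /k; lia.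
by apply/jB/(Gle _ (Gqv k)); rewrite /k; lia.
Qed.

(** Three sequences of counterexamples [a], [b], [c] would converge along a
    common subsequence; since [G j (a j, b j)] and [G j (b j, c j)], their
    limits agree, say with [p], so that [(a, c)] ends up in the neighbourhood
    [G n] of [(p, p)]. *)
Lemma G_local_split x n : exists m, forall a b c,
  T m (x, a) -> T m (x, b) -> T m (x, c) ->
  G m (a, b) -> G m (b, c) -> G n (a, c).
Proof.
apply: contrapT => /forallNP nsplit.
have /choice[w wP] : forall m, exists w : X * X * X,
    [/\ T m (x, w.1.1), T m (x, w.1.2) & T m (x, w.2)] /\
    [/\ G m (w.1.1, w.1.2), G m (w.1.2, w.2) & ~ G n (w.1.1, w.2)].
  move=> m; apply: contrapT => /forallNP h; apply: (nsplit m).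
  move=> a b c xa xb xc ab bc; apply: contrapT => ac.
  by apply: (h (a, b, c)).
have [p [f fle fP]] : exists p, exists2 f : nat -> nat,
    (forall j, (j <= f j)%N) & forall j, G j (p, (w (f j)).1.1).
  apply: (@cluster_subsequence x (fun m => (w m).1.1)) => m.
  by have [[]] := wP m.
have [q [g gle gP]] : exists q, exists2 g : nat -> nat,
    (forall j, (j <= g j)%N) & forall j, G j (q, (w (f (g j))).1.2).
  apply: (@cluster_subsequence x (fun m => (w (f m)).1.2)) => m.
  by apply: (Tle (fle m)); have [[]] := wP (f m).
have [r [h hle hP]] : exists r, exists2 h : nat -> nat,
    (forall j, (j <= h j)%N) & forall j, G j (r, (w (f (g (h j)))).2).
  apply: (@cluster_subsequence x (fun m => (w (f (g m))).2)) => m.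
  by apply: (Tle (leq_trans (gle m) (fle _))); have [[]] := wP (f (g m)).
pose s j := f (g (h j)).
have les j : (j <= s j)%N.
  exact: leq_trans (hle j) (leq_trans (gle _) (fle _)).
have Ga j : G j (p, (w (s j)).1.1).
  by apply: Gle (fP _); exact: leq_trans (hle j) (gle _).
have Gb j : G j (q, (w (s j)).1.2) by exact: Gle (hle j) (gP _).
have Gab j : G j ((w (s j)).1.1, (w (s j)).1.2).
  by apply: (Gle (les j)); have [_ []] := wP (s j).
have Gbc j : G j ((w (s j)).1.2, (w (s j)).2).
  by apply: (Gle (les j)); have [_ []] := wP (s j).
have pq := Glim Gab Ga Gb; have qr := Glim Gbc Gb hP.
have [[A B] /= [Ap Bp] AB] := Gdiag_nbhs n p.
have [i iA] := G_base Ap; have [k kB] := G_base Bp.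
have [_ [_ _]] := wP (s (maxn i k)); apply; apply: AB; split => /=.
  by apply/iA/(Gle _ (Ga _)); rewrite leq_maxl.
by apply/kB; rewrite pq qr; apply: Gle (hP _); rewrite leq_maxr.
Qed.

(** If the index [f x] stands for a radius [2 ^ - (f x)], this plays the part of
    the Lipschitz condition on radii: points that are close at the scale of the
    radius have comparable radii.  By symmetry it also bounds [f x] by
    [(f y).+1]. *)
Definition slow (f : X -> nat) :=
  forall x y, T (f x) (x, y) -> (f y <= (f x).+1)%N.

Definition slow_entourage (f : X -> nat) : set (X * X) :=
  [set xy | G (f xy.1) xy].

(** The index [k x] is the least one for which [G m \; G m] is included in
    [slow_entourage f] on [T m [x]].  Minimality makes [k] slow: an index that
    works at [x] works, once increased by 1, at each point of [T m.+1 [x]]. *)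
Lemma slow_entourage_split (f : X -> nat) : slow f -> exists f', [/\ slow f',
  forall x, (f x < f' x)%N,
  forall x y, slow_entourage f' (x, y) -> slow_entourage f (y, x) &
  forall x y z, slow_entourage f' (x, y) -> slow_entourage f' (y, z) ->
    slow_entourage f (x, z)].
Proof.
move=> fslow.
pose Q x m := `[< forall a b c, T m (x, a) -> T m (x, b) -> T m (x, c) ->
  G m (a, b) -> G m (b, c) -> G (f a) (a, c) >].
have Qex x : exists m, Q x m.
  have [m mP] := G_local_split x (f x).+1; exists (maxn m (f x)).
  apply/asboolP => a b c xa xb xc ab bc.
  have fa : (f a <= (f x).+1)%N by apply/fslow/(Tle _ xa); rewrite leq_maxr.
  apply: Gle fa _; apply: mP (Gle _ ab) (Gle _ bc); rewrite ?leq_maxl//;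
    by [apply: Tle xa; rewrite leq_maxl|apply: Tle xb; rewrite leq_maxl|
        apply: Tle xc; rewrite leq_maxl].
have QS x y m : Q x m -> T m.+1 (x, y) -> Q y m.+1.
  move=> /asboolP Qx xy; apply/asboolP => a b c ya yb yc ab bc.
  by apply: (Qx a b c); [exact: Ttri xy _|exact: Ttri xy _|exact: Ttri xy _|
     exact: GS|exact: GS].
pose k x := ex_minn (Qex x).
have Qk x : Q x (k x) by rewrite /k; case: ex_minnP.
have kmin x m : Q x m -> (k x <= m)%N.
  by rewrite /k; case: ex_minnP => i _ + Qm; apply.
(* In a composition from [x] through [y], one unit of the margin 2 is lost when
   passing from [f' x] to [f' y], the other one in the composition of [T]. *)
pose f' x := (maxn (k x) (f x) + 2)%N.
have f'slow : slow f'.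
  move=> x y xy; have kS : (k y <= (k x).+1)%N.
    by apply/kmin/(QS x) => //; apply: Tle xy; rewrite /f'; lia.
  have fS : (f y <= (f x).+1)%N by apply/fslow/(Tle _ xy); rewrite /f'; lia.
  by rewrite /f'; lia.
exists f'; split => //.
- by move=> x; rewrite /f'; lia.
- move=> x y /= xy; apply/Gsym/(Gle _ xy) => /=.
  have : (f y <= (f x).+1)%N.
    by apply/fslow/GT/(Gle _ xy); rewrite /f' /=; lia.
  by rewrite /f'; lia.
- move=> x y z; rewrite /slow_entourage /= => xy yz.
  have f'xy : (f' x <= (f' y).+1)%N.
    have [le_yx|/ltnW] := leqP (f' y) (f' x); last by move/leq_trans; apply.
    by apply/f'slow/Tsym/(Tle le_yx)/GT.
  have kx : ((k x).+1 < f' x)%N by rewrite /f'; lia.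
  have ky : (k x < f' y)%N by lia.
  have Txy : T (k x).+1 (x, y) by apply/GT/(Gle _ xy); lia.
  have Tyz : T (k x).+1 (y, z) by apply/GT/(Gle _ yz); lia.
  have /asboolP := Qk x; apply; [exact: Txx|exact: Tle Txy|exact: Ttri Tyz| |].
    by apply: Gle xy; lia.
  by apply: Gle yz; lia.
Qed.

(** The iteration starts from the constant index 0; the index is at least [n]
    after [n] steps, so the resulting relations are included in the [G n]. *)
Lemma closure_diagonal_metrizable (R : realType) : metrizable R X.
Proof.
have /choice[next nextP] : forall f, exists f', slow f -> [/\ slow f',
  forall x, (f x < f' x)%N,
  forall x y, slow_entourage f' (x, y) -> slow_entourage f (y, x) &
  forall x y z, slow_entourage f' (x, y) -> slow_entourage f' (y, z) ->
    slow_entourage f (x, z)].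
  move=> f; have [/slow_entourage_split[f' f'P]|nf] := pselect (slow f).
    by exists f'.
  by exists f => /nf.
pose F n := iter n next (fun=> 0%N).
have Fslow n : slow (F n) by elim: n => [//|n /nextP[]].
have Fge n x : (n <= F n x)%N.
  elim: n => // n IH; have [_ /(_ x) + _ _] := nextP _ (Fslow n).
  exact: leq_ltn_trans.
apply: (@metrizable_entourage_seq _ _ (fun n => slow_entourage (F n))).
- by move=> n x; exact: Gxx.
- by move=> n x y; have [_ _ + _] := nextP _ (Fslow n); apply.
- by move=> n x y z; have [_ _ _] := nextP _ (Fslow n); apply.
- by move=> x y xy; apply: Gdiag => n; apply/subset_closure/(Gle (Fge n x))/xy.
- move=> x A; split=> [/G_base[n nA]|[n nA]].
    by exists n => y xy; apply: nA; exact: Gle (Fge n x) xy.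
  by apply: filterS (Gnbhs (F n x) x) => y xy; exact: nA.
Qed.

End closure_diagonal.

(** The hypothesis bears on closures because a limit of pairs chosen in the sets
    [D n] is only known to lie in their closures. *)
Lemma M_space_metrizable (R : realType) (X : topologicalType)
    (D : nat -> set (X * X)) : M_space X ->
  (forall n, open (D n)) -> (forall n x, D n (x, x)) ->
  (forall x y, (forall n, closure (D n) (x, y)) -> x = y) ->
  metrizable R X.
Proof.
move=> /M_space_entourages[T [Topen Txx Tsym Ttri Tclust]] Dopen Dxx Ddiag.
pose swap (xy : X * X) := (xy.2, xy.1).
have swap_cont : continuous swap.
  by move=> xy; apply: cvg_pair => /=; [exact: cvg_snd|exact: cvg_fst].
pose G n := \bigcap_(i < n.+1) (D i `&` swap @^-1` (D i) `&` T i).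
apply: (@closure_diagonal_metrizable X T G) => //.
- move=> n; rewrite /G bigcap_mkord.
  elim/big_ind : _ => [|A B oA oB|i _]; [exact: openT|exact: openI|].
  apply: openI => //; apply: openI => //.
  by apply: open_comp => // xy _; exact: swap_cont.
- by move=> n x i _; split => //; split => //; exact: Dxx.
- move=> n x y Gxy i i_n; have [[Dxy Dyx] Txy] := Gxy i i_n.
  by split; [split|exact: Tsym].
- by move=> n x y Gxy i i_n; apply: Gxy; exact: ltnW.
- by move=> n x y /(_ n (ltnSn n))[].
- move=> x y Gxy; apply: Ddiag => n; apply: closureS (Gxy n).
  by move=> xy /(_ n (ltnSn n))[[]].
Qed.

(** * Closed neighbourhoods of a metrizable retract *)

(** The pseudometric [delta] is the metric of [E] pulled back along a retraction
    onto [E].  As in the proof that metric spaces are paracompact, the cover of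
    [E] by the sets [N e] is well-ordered and refined by the families, indexed
    by [n], of the balls of radius [r n] around points of [Y n]: those attached
    to different members of the cover are separated, so that closures commute
    with the unions [W n]. *)
Lemma retract_closure_sandwich (R : realType) (S : topologicalType)
    (E O : set S) (delta : S -> S -> R) :
  regular_space S ->
  (forall x, delta x x = 0%R) ->
  (forall x y, delta x y = delta y x) ->
  (forall x y z, (delta x z <= delta x y + delta y z)%R) ->
  (forall x r, open [set y | (delta x y < r)%R]) ->
  (forall x, exists2 e, E e & delta x e = 0%R) ->
  (forall e A, E e -> open A -> A e ->
    exists2 r, (0 < r)%R & forall u, E u -> (delta e u < r)%R -> A u) ->
  open O -> E `<=` O ->
  exists Z : nat -> set S, [/\ forall n, open (Z n), forall n, E `<=` Z n &
    \bigcap_n closure (Z n) `<=` O].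
Proof.
move=> regS dxx dsym dtri dopen retr base oO EO.
have /choice[N NP] : forall e, exists A, E e ->
    [/\ open A, A e & closure A `<=` O].
  move=> e; have [Ee|nEe] := pselect (E e); last by exists set0.
  have /regS[A eA AO] : nbhs e O.
    by apply: open_nbhs_nbhs; split => //; exact: EO.
  exists A°; split => //; first exact: open_interior.
  by apply: subset_trans AO; apply: closureS; exact: interior_subset.
have [le wo_le] := well_ordering_principle S.
have /choice[first firstP] : forall u, exists e, E u -> [/\ E e, N e u &
    forall e', E e' -> N e' u -> le e e'].
  move=> u; have [Eu|nEu] := pselect (E u); last by exists u.
  have [|e [[eA emin] _]] := wo_le [pred e | `[< E e /\ N e u >]].
    exists u; rewrite unfold_in; apply/asboolP; split => //.
    by have [] := NP _ Eu.
  move: eA; rewrite unfold_in => /asboolP[Ee Neu].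
  exists e; split => // e' Ee' Ne'u.
  by apply: emin; rewrite unfold_in; apply/asboolP.
have le_anti e e' : le e e' -> le e' e -> e = e'.
  move=> ee' e'e; apply: (wo_chain_antisymmetric (withinW wo_le)) => //.
  by rewrite ee'.
(* The index of the first neighbourhood [N e] which contains [u] is used for
   [u]; only points [u] deep inside [N (first u)] belong to [Y n]. *)
pose r n : R := (n.+1%:R^-1)%R.
have r0 n : (0 < r n)%R by rewrite invr_gt0.
pose Y n : set S := [set u | E u /\
  forall v, E v -> (delta u v < 3 * r n)%R -> N (first u) v].
have YE u : E u -> exists n, Y n u.
  move=> Eu; have [Ef Nfu _] := firstP u Eu; have [oN _ _] := NP _ Ef.
  have [e e0 eN] := base u _ Eu oN Nfu.
  have [n ne] : exists n, (3 * r n < e)%R.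
    have e30 : (0 < e / 3)%R by rewrite divr_gt0.
    by have [n] := ltr_add_invr e30; rewrite add0r -/(r n) => rn; exists n; lra.
  by exists n; split => // v Ev uv; apply: eN => //; exact: lt_trans ne.
pose W n : set S :=
  \bigcup_(u in Y n) ([set v | (delta u v < r n)%R] `&` N (first u)).
(* Adding the points close to [E `\` W n] makes [Z n] contain [E], without
   changing it near the points at distance 0 from [Y n]. *)
pose Z n : set S := W n `|`
  \bigcup_(w in E `\` W n) [set v | (delta w v < r n / 2)%R].
have YN n u v : Y n u -> E v -> (delta u v < 3 * r n)%R -> N (first u) v.
  by move=> [_]; exact.
exists Z; split.
- move=> n; apply: openU; apply: bigcup_open => w.
    move=> [Ew _]; apply: openI; first exact: dopen.
    by have [Ef _ _] := firstP _ Ew; have [] := NP _ Ef.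
  by move=> _; exact: dopen.
- move=> n e Ee; have [We|nWe] := pselect (W n e); first by left.
  by right; exists e => //=; rewrite dxx divr_gt0.
move=> y clZ; have [e Ee ye] := retr y.
have [n Yne] := YE _ Ee.
have Ef := (firstP _ Ee).
suff clN : closure (N (first e)) y.
  by have [Ef' _ _] := Ef; have [_ _] := NP _ Ef'; exact.
move=> B yB.
have yball : nbhs y [set v | (delta y v < r n / 2)%R].
  by apply: open_nbhs_nbhs; split; [exact: dopen|rewrite /= dxx divr_gt0].
have [v [Zv [Bv /= yv]]] := clZ n I _ (filterI yB yball).
case: Zv => [[u Yu [/= uv Nv]]|[w [Ew nWw] /= wv]]; last first.
  exfalso; apply: nWw; exists e => //; split => /=.
    have := dtri e y w; have := dtri y v w; rewrite (dsym e y) (dsym v w) ye.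
    lra.
  apply: (YN n) => //.
  have := dtri e y w; have := dtri y v w; rewrite (dsym e y) (dsym v w) ye.
  have := r0 n; lra.
(* Near [y] only [N (first e)] contributes to [W n]: the points [e] and [u] of
   [Y n] are so close that each lies in the neighbourhood chosen for the
   other, and both neighbourhoods are the first ones. *)
exists v; split => //.
have eu : (delta e u < 3 * r n)%R.
  have := dtri e y u; have := dtri y v u; rewrite (dsym e y) (dsym v u) ye.
  have := r0 n; lra.
have [Eu _] := Yu.
have [Efu _ minu] := firstP _ Eu; have [Efe _ mine] := firstP _ Ee.
rewrite (_ : first e = first u)//; apply: le_anti.
  apply: mine => //; apply: (YN n u) => //; rewrite dsym//.
by apply: minu => //; apply: (YN n e).
Qed.

(** * Clifford semigroups *)

Lemma continuous_mulg (S : topologicalSemigroupType) (Y : topologicalType)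
    (f g : Y -> S) : continuous f -> continuous g ->
  continuous (fun x => (f x * g x)%g).
Proof.
move=> fc gc x; apply: (@continuous_comp _ _ _ (fun x => (f x, g x))
  (fun p : S * S => (p.1 * p.2)%g)); last exact: Defs.mul_continuous.
by apply: cvg_pair; [exact: fc|exact: gc].
Qed.

Section clifford.
Context (S : topologicalSemigroupType).
Hypothesis cliffordS : clifford S.
Local Open Scope group_scope.

(** The identity of the maximal subgroup that contains [x]. *)
Definition local_unit (x : S) : S := x * inversion x.

Lemma local_unit_idempotent x : idempotents S (local_unit x).
Proof.
have [xix _ _] := inversionP x cliffordS.
by rewrite /idempotents /= /local_unit mulgA xix.
Qed.

Lemma local_unit_id e : idempotents S e -> local_unit e = e.
Proof.
move=> ee; rewrite /local_unit (_ : inversion e = e)//.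
apply: (is_inverse_uniq (inversionP e cliffordS)).
by split; rewrite ?ee.
Qed.

(** In the common maximal subgroup of [a] and [b], the idempotent
    [inversion a * b] is the identity. *)
Lemma clifford_unit_eq (a b : S) : local_unit a = local_unit b ->
  idempotents S (inversion a * b) -> a = b.
Proof.
rewrite /local_unit /idempotents /=.
have [aia iai ca] := inversionP a cliffordS.
have [bib ibi cb] := inversionP b cliffordS.
set i := inversion a in aia iai ca *; set j := inversion b in bib ibi cb *.
move=> ab ff.
have fe : i * b * (a * i) = i * b by rewrite ab cb -mulgA (mulgA b) bib.
have fg : i * b * (j * a) = a * i.
  by rewrite mulgA -(mulgA i b j) -ab (mulgA i a i) iai.
have f1 : i * b = a * i by rewrite -[LHS]fe -fg mulgA ff.
by rewrite -[RHS]bib -ab -mulgA f1 ca mulgA aia.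
Qed.

End clifford.

(** * Metric spaces *)

Section metric.
Context (R : realType) (X : topologicalType) (d : X -> X -> R).
Hypothesis d_metric : is_metric d.
Hypothesis d_open : forall A : set X, open A <->
  (forall x, A x -> exists2 e : R, (0 < e)%R & [set y | (d x y < e)%R] `<=` A).

Lemma metric_ball_open x (e : R) : open [set y | (d x y < e)%R].
Proof.
have [_ _ _ dtri] := d_metric.
apply/d_open => y /= xy; exists (e - d x y)%R; first by rewrite subr_gt0.
by move=> z /= yz; apply: le_lt_trans (dtri x y z) _; rewrite addrC -ltrBrDr.
Qed.

Lemma metric_nbhs x A : nbhs x A ->
  exists2 e : R, (0 < e)%R & [set y | (d x y < e)%R] `<=` A.
Proof.
rewrite nbhsE => -[B [/d_open oB Bx] BA]; have [e e0 eB] := oB _ Bx.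
by exists e => //; exact: subset_trans BA.
Qed.

Lemma metrizable_set_type (E : set X) : metrizable R (set_type E).
Proof.
have [dge0 d0 dsym dtri] := d_metric.
exists (fun x y : set_type E => d (val x) (val y)).
  split=> [x y|x y|x y|x y z] //.
  by split=> [/d0/val_inj//|->]; exact/d0.
move=> A; split=> [[B oB <-] x /= Bx|hA].
  have [e e0 eB] := (d_open B).1 oB _ Bx.
  by exists e => // y; exact: eB.
exists (\bigcup_(ex in [set ex : R * set_type E | (0 < ex.1)%R /\
    [set y | (d (val ex.2) (val y) < ex.1)%R] `<=` A])
  [set y | (d (val ex.2) y < ex.1)%R]).
  by apply: bigcup_open => -[e x] _; exact: metric_ball_open.
apply/seteqP; split=> [y [[e x] /= [e0 eA] xy]|x Ax]; first exact: eA.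
have [e e0 eA] := hA _ Ax; exists (e, x) => //=.
by rewrite (_ : d _ _ = 0%R)//; exact/d0.
Qed.

(** The covers are made of the balls of radius [r n = 4 ^ - n]: the star of such
    a ball is contained in the concentric ball of radius [3 * r n]. *)
Lemma metric_M_space : M_space X.
Proof.
have [dge0 d0 dsym dtri] := d_metric.
have dxx x : d x x = 0%R by exact/d0.
pose r n : R := ((4 ^+ n)^-1)%R.
have r0 n : (0 < r n)%R by rewrite invr_gt0 exprn_gt0.
have rS n : (r n = 4 * r n.+1)%R.
  by rewrite /r exprS invfM mulrA mulfV// mul1r.
exists (fun n => range (fun x => [set y | (d x y < r n)%R])); split.
- move=> n; split=> [A [x _ <-]|]; first exact: metric_ball_open.
  apply/seteqP; split=> // x _; exists [set y | (d x y < r n)%R].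
    by exists x.
  by rewrite /= dxx.
- move=> n A [x _ <-]; exists [set y | (d x y < r n)%R]; first by exists x.
  move=> y [B [[z _ <-] [w [/= zw xw]]] /= zy].
  rewrite rS; have := r0 n.+1.
  have := dtri x w y; have := dtri w z y; rewrite (dsym w z); lra.
- move=> x u Ux; exists x => A B [N _ NA] /metric_nbhs[e e0 eB].
  have [n nN ne] : exists2 n, (N <= n)%N & (2 * r n < e)%R.
    have e20 : (0 < e / 2)%R by rewrite divr_gt0.
    have [k] := ltr_add_invr e20; rewrite add0r => ke.
    exists (maxn N k); first exact: leq_maxl.
    have : (r (maxn N k) <= k.+1%:R^-1)%R.
      rewrite lef_pV2 ?posrE ?exprn_gt0// -natrX ler_nat.
      exact: leq_ltn_trans (leq_maxr N k) (ltn_expl _ _).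
    by move=> rk; rewrite mulrC -ltr_pdivlMr//; exact: le_lt_trans ke.
  exists (u n); split; first exact: NA.
  apply: eB => /=; apply: lt_trans ne.
  have [B' [[z _ <-] /= zx] zu] := Ux n; rewrite /= in zu.
  have := dtri x z (u n); rewrite (dsym x z); lra.
Qed.

Lemma metric_fixed_points_Gdelta (f : X -> X) : continuous f ->
  Gdelta [set x | f x = x].
Proof.
have [dge0 d0 dsym dtri] := d_metric.
move=> fcont.
exists (fun n => [set x | (d (f x) x < n.+1%:R^-1)%R]) => [n|].
  rewrite openE => x /=; move: (n.+1%:R^-1)%R => t fx.
  pose e := ((t - d (f x) x) / 2)%R.
  have e0 : (0 < e)%R by rewrite divr_gt0// subr_gt0.
  have ball_nbhs z : nbhs z [set y | (d z y < e)%R].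
    apply: open_nbhs_nbhs; split; first exact: metric_ball_open.
    by rewrite /= (_ : d z z = 0%R)//; exact/d0.
  have fx_nbhs : nbhs x (f @^-1` [set y | (d (f x) y < e)%R]).
    exact/fcont/ball_nbhs.
  apply: filterS (filterI fx_nbhs (ball_nbhs x)) => y /= [fxy xy].
  have := dtri (f y) (f x) y; have := dtri (f x) x y.
  rewrite (dsym (f y) (f x)).
  by rewrite /e in fxy xy; lra.
apply/seteqP; split=> x /= fx.
  by move=> n _ /=; rewrite fx (_ : d x x = 0%R) ?invr_gt0//; exact/d0.
apply/d0/eqP; rewrite eq_le dge0 andbT leNgt; apply/negP => pos.
have [n] := ltr_add_invr pos; rewrite add0r => /ltW; rewrite leNgt.
by have /= -> := fx n I.
Qed.

End metric.

(** * Metrizability of topological Clifford semigroups *)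

Lemma clifford_metrizable (R : realType) (S : topologicalSemigroupType) :
  regular_space S -> clifford S -> continuous (inversion : S -> S) ->
  M_space S -> metrizable R (set_type (idempotents S)) ->
  Gdelta (idempotents S) -> metrizable R S.
Proof.
move=> regS cliffordS invS MS [d dm dopen] [W Wopen EW].
have [dge0 d0 dsym dtri] := dm.
pose p := @local_unit S.
have p_cont : continuous p.
  by apply: continuous_mulg => // x; exact: cvg_id.
have pE x : p x \in idempotents S by apply/mem_set/local_unit_idempotent.
have pid e : idempotents S e -> p e = e by exact: local_unit_id.
pose q (x : S) : set_type (idempotents S) := SigSub (pE x).
pose delta (x y : S) := d (q x) (q y).
have q_cont (A : set (set_type (idempotents S))) : open A -> open (q @^-1` A).
  move=> [B oB <-]; rewrite (_ : _ @^-1` _ = p @^-1` B)//.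
  by apply: open_comp => // x _; exact: p_cont.
have delta_open x r : open [set y | (delta x y < r)%R].
  exact: (q_cont _ (metric_ball_open dm dopen (q x) r)).
have deltaxx x : delta x x = 0%R by exact/d0.
have delta_nbhs x e : (0 < e)%R -> nbhs x [set y | (delta x y < e)%R].
  move=> e0; apply: open_nbhs_nbhs; split; first exact: delta_open.
  by rewrite /= deltaxx.
have quot_cont : continuous (fun ab : S * S => (inversion ab.1 * ab.2)%g).
  apply: continuous_mulg => ab; last exact: cvg_snd.
  apply: (@continuous_comp _ _ _ fst inversion); first exact: cvg_fst.
  exact: invS.
have qp x : q (p x) = q x by apply: val_inj; rewrite /= pid//; exact/set_mem.
have /choice[Z ZP] : forall j, exists Z : nat -> set S,
    [/\ forall n, open (Z n), forall n, idempotents S `<=` Z n &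
      \bigcap_n closure (Z n) `<=` W j].
  move=> j; apply: (retract_closure_sandwich (delta := delta)) => //.
  - by move=> x y; exact: dsym.
  - by move=> x y z; exact: dtri.
  - move=> x; exists (p x); first exact/set_mem/pE.
    by rewrite /delta qp; exact/d0.
  - move=> e A Ee oA Ae.
    have oA' : open (val @^-1` A : set (set_type (idempotents S))).
      by exists A.
    have [|r r0 rA] := (dopen _).1 oA' (q e); first by rewrite /= pid.
    exists r => // u Eu eu; have := rA (q u) eu.
    by rewrite /= pid.
  - by move=> e; rewrite EW => /(_ j I).
pose r n : R := (n.+1%:R^-1)%R.
pose D (jn : nat * nat) : set (S * S) :=
  [set ab | (delta ab.1 ab.2 < r jn.2)%R /\
    Z jn.1 jn.2 (inversion ab.1 * ab.2)%g].
have r0 n : (0 < r n)%R by rewrite invr_gt0.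
have D_open jn : open (D jn).
  apply: openI; last first.
    apply: (open_comp (f := fun ab : S * S => (inversion ab.1 * ab.2)%g)).
      by move=> ab _; exact: quot_cont.
    by have [+ _ _] := ZP jn.1; exact.
  rewrite openE => -[a b] /= ab.
  pose e := ((r jn.2 - delta a b) / 2)%R.
  have e0 : (0 < e)%R by rewrite divr_gt0// subr_gt0.
  exists ([set y | (delta a y < e)%R], [set y | (delta b y < e)%R]).
    by split; exact: delta_nbhs.
  move=> [u v] /= [au bv].
  have := dtri (q u) (q a) (q v); have := dtri (q a) (q b) (q v).
  rewrite (dsym (q u) (q a)) -!/(delta _ _); rewrite /e in au bv; lra.
pose D' n := if unpickle n is Some jn then D jn else setT.
apply: (@M_space_metrizable _ _ D') => //.
- move=> n; rewrite /D'; case: unpickle => [jn|]; [exact: D_open|exact: openT].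
- move=> n x; rewrite /D'; case: unpickle => // -[j m]; split.
    by rewrite /= deltaxx.
  have [_ + _] := ZP j; apply; have [_ _ <-] := inversionP x cliffordS.
  exact/set_mem/pE.
move=> a b abD; have {}abD jn : closure (D jn) (a, b).
  by have := abD (pickle jn); rewrite /D' pickleK.
apply: clifford_unit_eq => //.
  have dab : d (q a) (q b) = 0%R.
    (* On the closure of [D (0, n)], [delta] is at most [3 * r n]. *)
    apply/eqP; rewrite eq_le dge0 andbT leNgt; apply/negP => pos.
    have pos3 : (0 < d (q a) (q b) / 3)%R by rewrite divr_gt0.
    have [n] := ltr_add_invr pos3; rewrite add0r -/(r n) => rn.
    have abn : nbhs (a, b)
        ([set y | (delta a y < r n)%R] `*` [set y | (delta b y < r n)%R]).
      exists ([set y | (delta a y < r n)%R], [set y | (delta b y < r n)%R]).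
        by split; exact: delta_nbhs.
      by [].
    have [[u v] /= [[/= uv _] [/= au bv]]] := abD (0, n) _ abn.
    have := dtri (q a) (q u) (q b); have := dtri (q u) (q v) (q b).
    by rewrite (dsym (q v) (q b)); rewrite /delta in uv au bv; lra.
  by have /d0/(congr1 val) := dab.
rewrite EW => j _; have [_ _ +] := ZP j; apply => n _.
move=> B /(quot_cont (a, b)) /= /(abD (j, n))[uv [[_ Zuv] Buv]].
by exists (inversion uv.1 * uv.2)%g.
Qed.

Theorem theorem2p4 (R : realType) (S : topologicalSemigroupType)
  (regS : regular_space S) (T1S : accessible_space S)
  (cliffordS : clifford S) (invS : continuous (inversion : S -> S)) :
  metrizable R S <->
  [/\ M_space S, metrizable R (set_type (idempotents S))
    & Gdelta (idempotents S)].
Proof.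
split=> [[d dm dopen]|[MS mE GE]]; last exact: clifford_metrizable.
split; first exact: (metric_M_space dm dopen).
  exact: (metrizable_set_type dm dopen).
apply: (metric_fixed_points_Gdelta dm dopen (f := fun x : S => (x * x)%g)).
by apply: continuous_mulg => x; exact: cvg_id.
Qed.
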